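(* Let $\theta>0$, let $\mathcal{L}$ be the uniform distribution on the unit circle, and for $N\ge1$ let $M_N$ be a random matrix following the law $\mathbb{P}(N,\theta,\mathcal{L})$. Then the distributions of the random measures $\tau_N(M_N)$ ($N\ge1$) and $\tau_\infty(\theta,\mathcal{L})$ on $\mathbb{R}$ are invariant by translation.
   Context: $\Sigma_N$ is the group of permutations of $\{1,\dots,N\}$. For $\sigma\in\Sigma_N$ and $z_1,\dots,z_N\in\mathbb{C}^*$, $M(\sigma,z_1,\dots,z_N)$ is the $N\times N$ matrix $M$ with entries $M_{jk}=z_j\mathbf{1}_{j=\sigma(k)}$. $\mathbb{P}(N,\theta,\mathcal{L})$ is the law of $M(\sigma,z_1,\dots,z_N)$ where $\sigma$ follows the Ewens measure of parameter $\theta$ on $\Sigma_N$ (each permutation has probability proportional to $\theta^n$, $n$ its number of cycles), $z_1,\dots,z_N$ have law $\mathcal{L}$, and $\sigma,z_1,\dots,z_N$ are independent. $\tau_N(M_N)$ is the point measure on $\mathbb{R}$ $$\tau_N(M_N)=\sum_{x\in\mathbb{R}:\ e^{2i\pi x/N}\text{ eigenvalue of }M_N}m(x)\,\delta_x,$$ where $m(x)$ is the multiplicity of the eigenvalue $e^{2i\pi x/N}$ of $M_N$. For $\mathcal{L}$ uniform on the unit circle, $\tau_\infty(\theta,\mathcal{L})=\sum_{m=1}^\infty\sum_{k\in\mathbb{Z}}\delta_{(k+\chi_m)/x_m}$, where $(x_m)_{m\ge1}$ is a Poisson-Dirichlet process of parameter $\theta$ and $(\chi_m)_{m\ge1}$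 is an independent sequence of i.i.d. uniform random variables on $[0,1)$. A GEM process of parameter $\theta$ is a sequence $y_m=V_m\prod_{i<m}(1-V_i)$ with $(V_i)$ i.i.d. of density $\theta(1-x)^{\theta-1}$ on $(0,1)$; a Poisson-Dirichlet process of parameter $\theta$ has the law of the decreasing rearrangement of a GEM($\theta$) process. *)

(* Defs.v *)
From HB Require Import structures.
From mathcomp Require Import all_boot all_order all_algebra all_fingroup.
From mathcomp Require Import finmap complex.
From mathcomp Require Import all_classical all_reals all_analysis.
From mathcomp Require Import measurable_realfun.

Set Implicit Arguments.
Unset Strict Implicit.
Unset Printing Implicit Defensive.

Import Order.TTheory GRing.Theory Num.Theory.
Import numFieldNormedType.Exports.

Local Open Scope classical_set_scope.
Local Open Scope ring_scope.

HB.instance Definition _ (T : finType) := isPointed.Build (perm_type T) (1%g : {perm T}).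
HB.instance Definition _ (T : finType) :=
  @isMeasurable.Build default_measure_display (perm_type T)
    discrete_measurable discrete_measurable0
    discrete_measurableC discrete_measurableU.

(* The Borel sigma-algebra of the complex numbers, seen as the plane. *)
Section complex_measurable.
Variable R : realType.

Definition complex_measurable : set (set R[i]) :=
  g_sigma_preimageU (@complex.Re R) (@complex.Im R).

HB.instance Definition _ := isPointed.Build R[i] 0.
HB.instance Definition _ :=
  @isMeasurable.Build default_measure_display R[i] complex_measurable
    (@sigma_algebra0 _ setT _) (@sigma_algebraC _ _)
    (@sigma_algebra_bigcup _ setT _).
End complex_measurable.

Section matrix_measurable.
Context d (T : measurableType d) (m n : nat).

Definition matrix_measurable : set (set 'M[T]_(m, n)) :=
  <<s \bigcup_(ij in [set: 'I_m * 'I_n])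
        preimage_set_system setT (fun M : 'M[T]_(m, n) => M ij.1 ij.2)
          measurable >>.

HB.instance Definition _ :=
  @isMeasurable.Build default_measure_display 'M[T]_(m, n) matrix_measurable
    (@sigma_algebra0 _ setT _) (@sigma_algebraC _ _)
    (@sigma_algebra_bigcup _ setT _).
End matrix_measurable.

(* Real sequences, with the product sigma-algebra. *)
Definition rseq (R : realType) : Type := nat -> R.

Section rseq_measurable.
Variable R : realType.

Definition rseq_measurable : set (set (rseq R)) :=
  <<s \bigcup_(m in [set: nat])
        preimage_set_system setT (fun x : rseq R => x m) measurable >>.

HB.instance Definition _ := Pointed.copy (rseq R) (nat -> R).
HB.instance Definition _ :=
  @isMeasurable.Build default_measure_display (rseq R) rseq_measurable
    (@sigma_algebra0 _ setT _) (@sigma_algebraC _ _)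
    (@sigma_algebra_bigcup _ setT _).
End rseq_measurable.

(* The space of Borel measures on the line, with the sigma-algebra generated by
   the evaluations mu |-> mu B. On locally finite measures it is the Borel
   sigma-algebra of the vague topology. *)
Definition measures (R : realType) : Type := {measure set R -> \bar R}.

Section measures_measurable.
Variable R : realType.

Definition measures_measurable : set (set (measures R)) :=
  <<s \bigcup_(B in [set B : set R | measurable B])
        preimage_set_system setT (fun mu : measures R => mu B) measurable >>.

HB.instance Definition _ := gen_eqMixin (measures R).
HB.instance Definition _ := gen_choiceMixin (measures R).
HB.instance Definition _ := isPointed.Build (measures R) mzero.
HB.instance Definition _ :=
  @isMeasurable.Build default_measure_display (measures R) measures_measurable
    (@sigma_algebra0 _ setT _) (@sigma_algebraC _ _)
    (@sigma_algebra_bigcup _ setT _).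
End measures_measurable.

Definition eq_law d (T : measurableType d) (R : realType)
    (mu nu : set T -> \bar R) : Prop :=
  forall A, measurable A -> mu A = nu A.

Section independence.
Context d (Omega : measurableType d) (R : realType) (P : probability Omega R).

(* [F i] is meant to be a sub-sigma-algebra of [Omega]. *)
Definition mutually_independent (I : choiceType) (F : I -> set (set Omega)) :=
  forall (J : {fset I}) (A : I -> set Omega), (forall i, i \in J -> F i (A i)) ->
    P (\bigcap_(i in [set` J]) A i) = (\prod_(i <- J) P (A i))%E.

Definition independent d1 d2 (T1 : measurableType d1) (T2 : measurableType d2)
    (X : {RV P >-> T1}) (Y : {RV P >-> T2}) :=
  forall A B, measurable A -> measurable B ->
    P (X @^-1` A `&` Y @^-1` B) = (P (X @^-1` A) * P (Y @^-1` B))%E.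

Definition iid (X : {RV P >-> rseq R}) (mu : set R -> \bar R) : Prop :=
  mutually_independent
    (fun m => g_sigma_algebra_preimage (fun w => X w m : R)) /\
  forall m, eq_law (pushforward P (fun w => X w m : R)) mu.
End independence.

Section point_measure.
Variables (R : realType) (I : choiceType) (D : set I) (c : I -> nat) (p : I -> R).
Local Open Scope ereal_scope.

(* The sum over [i] in [D] of [c i] times the Dirac mass at [p i]. *)
Definition point_measure (A : set R) : \bar R :=
  \esum_(i in D) ((c i)%:R%:E * \d_(p i) A).

Let point_measure_term_ge0 A i : 0 <= (c i)%:R%:E * \d_(p i) A :> \bar R.
Proof. by rewrite mule_ge0// lee_fin. Qed.

Let point_measure0 : point_measure set0 = 0.
Proof. by apply: esum1 => i _; rewrite dirac0 mule0. Qed.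

Let point_measure_ge0 A : 0 <= point_measure A.
Proof. by apply: esum_ge0 => i _; exact: point_measure_term_ge0. Qed.

Let point_measureE A :
  point_measure A = \esum_(i in D `&` p @^-1` A) (c i)%:R%:E.
Proof.
rewrite esum_mkcondr; apply: eq_esum => i _.
by rewrite diracE (_ : (i \in p @^-1` A) = (p i \in A)) //;
  case: (_ \in _); rewrite ?mule1 ?mule0.
Qed.

Let point_measure_sigma_additive : semi_sigma_additive point_measure.
Proof.
move=> F mF tF mUF.
have -> : point_measure (\bigcup_n F n) =
    \sum_(0 <= n <oo) point_measure (F n).
  rewrite point_measureE preimage_bigcup setI_bigcupr nneseries_sum_bigcup//.
  - by apply: eq_eseriesr => n _; rewrite point_measureE.
  - by move=> i j _ _ [x [[_ Fi] [_ Fj]]]; apply: tF => //; exists (p x).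
by apply: is_cvg_ereal_nneg_natsum => n _; exact: point_measure_ge0.
Qed.

HB.instance Definition _ := isMeasure.Build _ _ _ point_measure
  point_measure0 point_measure_ge0 point_measure_sigma_additive.
End point_measure.

Section translate.
Variables (R : realType) (t : R) (mu : measures R).

Definition translate : set R -> \bar R := pushforward mu (fun x : R => x + t).

Let measurable_shift : measurable_fun [set: R] (fun x : R => x + t).
Proof. exact: measurable_funD. Qed.

Let translate0 : translate set0 = 0%E.
Proof. exact: measure0. Qed.

Let translate_ge0 A : (0 <= translate A)%E.
Proof. exact: measure_ge0. Qed.

Let translate_sigma_additive : semi_sigma_additive translate.
Proof. exact: measure_semi_sigma_additive. Qed.

HB.instance Definition _ := isMeasure.Build _ _ _ translate
  translate0 translate_ge0 translate_sigma_additive.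
End translate.

Definition translation_invariant_law d (Omega : measurableType d) (R : realType)
    (P : probability Omega R) (tau : Omega -> measures R) : Prop :=
  forall t : R,
    eq_law (pushforward P (fun w => translate t (tau w) : measures R))
           (pushforward P tau).

Section matrices.
Variable R : realType.

Definition expi (x : R) : R[i] := (cos x +i* sin x)%C.

Definition uniform01 : set R -> \bar R := uniform_prob (@ltr01 R).

Definition uniform_circle : set R[i] -> \bar R :=
  pushforward uniform01 (fun u : R => expi (2 * pi * u)).

Definition ewens_pmf (theta : R) (N : nat) (s : 'S_N) : R :=
  theta ^+ #|porbits s| / \sum_(s' : 'S_N) theta ^+ #|porbits s'|.

Definition perm_matrix (N : nat) (s : 'S_N) (z : 'I_N -> R[i]) : 'M[R[i]]_N :=
  \matrix_(j, k) (if j == s k then z j else 0).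

(* [M] follows the law of [perm_matrix s z], where [s] follows the Ewens measure
   of parameter [theta], each [z j] follows [L] and all are independent. *)
Definition follows_ewens_matrix_law (N : nat) (theta : R)
    (L : set R[i] -> \bar R) d (Omega : measurableType d)
    (P : probability Omega R) (M : {RV P >-> 'M[R[i]]_N}) : Prop :=
  exists (d' : measure_display) (Omega' : measurableType d')
    (P' : probability Omega' R)
    (s : {RV P' >-> 'S_N}) (z : 'I_N -> {RV P' >-> R[i]}),
  [/\ forall s0 : 'S_N, P' (s @^-1` [set s0]) = (ewens_pmf theta s0)%:E,
      forall j, eq_law (distribution P' (z j)) L,
      mutually_independent P' (fun o : option 'I_N =>
        if o is Some j then g_sigma_algebra_preimage (z j)
        else g_sigma_algebra_preimage s) &
      eq_law (distribution P M)
             (pushforward P' (fun w => perm_matrix (s w) (fun j => z j w)))].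

(* Multiplicities are algebraic: these matrices are diagonalizable as soon as
   the [z j] are nonzero, so this is also the geometric multiplicity. *)
Definition tau_N (N : nat) (M : 'M[R[i]]_N) : measures R :=
  point_measure
    [set x : R | eigenvalue M (expi (2 * pi * x / N%:R))]
    (fun x => mup (expi (2 * pi * x / N%:R)) (char_poly M)) id.
End matrices.

Section limit.
Variables (R : realType) (theta : R).

(* The law of the sticks, the beta distribution of parameters 1 and [theta]. *)
Definition gem_density (x : R) : R := theta * (1 - x) `^ (theta - 1).

Definition gem_stick_law (A : set R) : \bar R :=
  (\int[lebesgue_measure]_(x in A `&` `]0%R, 1%R[) (gem_density x)%:E)%E.

Definition is_gem d (Omega : measurableType d) (P : probability Omega R)
    (y : {RV P >-> rseq R}) : Prop :=
  exists V : {RV P >-> rseq R}, iid V gem_stick_law /\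
    forall w m, y w m = V w m * \prod_(i < m) (1 - V w i).

Definition decreasing_rearrangement (y x : rseq R) : Prop :=
  (forall m, x m.+1 <= x m) /\
  exists f : nat -> nat, bijective f /\ forall m, x m = y (f m).

Definition is_poisson_dirichlet d (Omega : measurableType d)
    (P : probability Omega R) (x : {RV P >-> rseq R}) : Prop :=
  exists (d' : measure_display) (Omega' : measurableType d')
    (P' : probability Omega' R) (y x' : {RV P' >-> rseq R}),
  [/\ is_gem y,
      {ae P', forall w, decreasing_rearrangement (y w) (x' w)} &
      eq_law (distribution P x) (distribution P' x')].

(* Sequences are indexed from 0 instead of 1, and [mk] stands for the pair (m, k). *)
Definition tau_infty (x chi : rseq R) : measures R :=
  point_measure [set: nat * int] (fun=> 1%N)
    (fun mk => (mk.2%:~R + chi mk.1) / x mk.1).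
End limit.

(* Main.v *)
Require Import Defs.
From mathcomp Require Import all_boot all_order all_algebra all_fingroup.
From mathcomp Require Import finmap complex.
From mathcomp Require Import all_classical all_reals all_analysis.
From mathcomp Require Import measurable_realfun.
From mathcomp Require Import ring lra zify.

Set Implicit Arguments.
Unset Strict Implicit.
Unset Printing Implicit Defensive.

Local Open Scope classical_set_scope.
Local Open Scope ring_scope.

Import Order.TTheory GRing.Theory Num.Theory.
Import numFieldNormedType.Exports.

(** The point process of eigenangles of a matrix [M] of size [N] is translated by
    [t] when [M] is multiplied by the complex number exp (2 i pi t / N)
    ([translate_tau_N]).  For a permutation matrix with entries [z j] this
    multiplies every [z j] by the same point of the circle, and since the [z j] are
    uniform on the circle, mutually independent and independent of the permutation,
    the law of the matrix does not change ([perm_matrix_rotation_law]).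

    In the limiting process the points attached to the weight [x m] form the
    lattice of step 1 / [x m] with phase [chi m].  Translating it by [t] replaces
    the phase by the fractional part of [chi m + t * x m] ([translate_tau_infty]);
    conditionally on the weights this is a deterministic shift modulo 1 of
    independent uniform variables, which preserves their law
    ([joint_law_shift_phases]).  Division by [x m] requires the weights to be
    nonzero, which holds almost surely ([poisson_dirichlet_neq0]).

    The rest is measurability: equality of laws is transported along the maps
    [tau_N] and [tau_infty], so these must be measurable.  For [tau_infty] the mass
    of a Borel set is a countable sum of measurable functions.  For [tau_N] the
    eigenvalues are not given as functions of the matrix, and measurability must be
    extracted from the characteristic polynomial.  The condition that some angle
    in an open interval has multiplicity at least [k] says that a function
    continuous in the angle and measurable in the matrix has a zero there
    ([measurable_angle_mult_hit]).  Separating the angles by rationals, these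
    conditions determine the number of eigenangles in an interval
    ([measurable_esum_itv]), and Dynkin's lemma passes from intervals to Borel
    sets ([measurable_random_measure]). *)

(** * Generated sigma-algebras, cylinders and spaces of measures *)

(** The image measure as a bundled measure, with the measurability proof as an
    explicit argument: uniqueness theorems take bundled measures. *)
Definition image_measure d d' (T1 : measurableType d) (T2 : measurableType d')
    (R : realType) (m : {measure set T1 -> \bar R}) (f : T1 -> T2)
    (mf : measurable_fun [set: T1] f) : {measure set T2 -> \bar R}.
Proof. exact: (pushforward m f : {measure set T2 -> \bar R}). Defined.

Section initial_structure.
Context d (T : measurableType d).

Lemma measurable_to_generated d' (U : measurableType d') (I : Type)
    dI (V : I -> measurableType dI) (D : set I) (X : forall i, U -> V i)
    (f : T -> U) :
  @measurable _ U =
    <<s \bigcup_(i in D) preimage_set_system setT (X i) measurable >> ->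
  (forall i, D i -> measurable_fun setT (X i \o f)) ->
  measurable_fun setT f.
Proof.
move=> mU mX; apply: (measurability _ mU) => _ [_ [i Di [B mB <-]] <-].
rewrite !setTI -[_ @^-1` _]setTI.
exact: mX.
Qed.

Lemma measurable_coordinate d' (U : measurableType d') (I : Type)
    dI (V : I -> measurableType dI) (D : set I) (X : forall i, U -> V i) i :
  @measurable _ U =
    <<s \bigcup_(i in D) preimage_set_system setT (X i) measurable >> ->
  D i -> measurable_fun setT (X i).
Proof.
move=> mU Di _ B mB; rewrite mU; apply: sub_sigma_algebra.
by exists i => //; exists B.
Qed.
End initial_structure.

Section cylinders.
Context (R : realType) d (T : measurableType d) (I : choiceType)
  dI (V : measurableType dI) (X : I -> T -> V).

(** Side conditions are imposed on the coordinates listed in [J] only, so that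
    infinite families [X] are covered. *)
Definition cylinder (J : seq I) (B : I -> set V) : set T :=
  [set w | forall i, i \in J -> B i (X i w)].

Hypothesis mT : @measurable _ T =
  <<s \bigcup_(i in [set: I]) preimage_set_system setT (X i) measurable >>.

Definition cylinders : set (set T) :=
  [set C | exists J, exists2 B, (forall i, measurable (B i)) &
     C = cylinder J B].

Lemma setI_closed_cylinders : setI_closed cylinders.
Proof.
move=> _ _ [J [B mB ->]] [K [C mC ->]].
exists (J ++ K), (fun i => (if i \in J then B i else setT) `&`
                           (if i \in K then C i else setT)).
  by move=> i; apply: measurableI; case: ifP.
apply/seteqP; split=> w.
  by move=> [wB wC] i _; split; case: ifP => // iJ; [exact: wB | exact: wC].
move=> wBC; split=> i iJ; have := wBC i; rewrite mem_cat iJ ?orbT.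
  by move=> /(_ isT)[].
by move=> /(_ isT)[].
Qed.

Lemma measurable_cylinders : @measurable _ T = <<s cylinders >>.
Proof.
rewrite mT; apply/seteqP; split.
  apply: smallest_sub; first exact: smallest_sigma_algebra.
  move=> _ [i _ [B mB <-]]; apply: sub_sigma_algebra.
  exists [:: i], (fun=> B) => //.
  apply/seteqP; split=> w /=; first by move=> [_ ?] j /[!inE] /eqP->.
  by move=> wB; split => //; apply: wB; rewrite inE.
rewrite -mT; apply: smallest_sub => //.
  by rewrite mT; exact: smallest_sigma_algebra.
move=> _ [J [B mB ->]].
have -> : cylinder J B = \bigcap_(i in [set` J]) (X i @^-1` B i) by [].
apply: fin_bigcap_measurable => // i _.
by rewrite -[_ @^-1` _]setTI; exact: (measurable_coordinate (D := setT) (X := X)).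
Qed.

(** The cylinders form a pi-system that contains the whole space and generates
    the sigma-algebra.  Each equality of laws below, on sequences and on
    matrices, is checked on cylinders, where independence turns it into an
    equality of products. *)
Lemma cylinder_measure_unique (m1 m2 : {measure set T -> \bar R}) :
  (m1 setT < +oo)%E ->
  (forall J B, (forall i, measurable (B i)) ->
    m1 (cylinder J B) = m2 (cylinder J B)) ->
  forall A, measurable A -> m1 A = m2 A.
Proof.
move=> m1oo m12; apply: (measure_unique cylinders (fun=> setT)) => //.
- exact: measurable_cylinders.
- exact: setI_closed_cylinders.
- by move=> _; exists [::], (fun=> setT) => //; apply/seteqP; split.
- by rewrite bigcup_const.
- by move=> _ [J [B mB ->]]; exact: m12.
Qed.
End cylinders.

Section measures_space.
Variable R : realType.

Lemma measurable_evaluation (B : set R) :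
  measurable B -> measurable_fun setT (fun mu : measures R => mu B).
Proof.
move=> mB; exact: (measurable_coordinate (D := [set B : set R | measurable B])
  (X := fun B (mu : measures R) => mu B)).
Qed.

Lemma measurable_to_measures d (T : measurableType d) (f : T -> measures R) :
  (forall B, measurable B -> measurable_fun setT (fun w => f w B)) ->
  measurable_fun setT f.
Proof.
move=> mf; exact: (measurable_to_generated (D := [set B : set R | measurable B])
  (X := fun B (mu : measures R) => mu B)).
Qed.

Lemma measurable_translate (t : R) :
  measurable_fun setT (fun mu : measures R => translate t mu : measures R).
Proof.
apply: measurable_to_measures => B mB; apply: measurable_evaluation.
rewrite -[_ @^-1` _]setTI; exact: measurable_funD.
Qed.
End measures_space.

(** * Shifts modulo 1 of the uniform law *)

Section uniform_shift.
Variable R : realType.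
Notation leb := (@lebesgue_measure R).

Lemma lebesgue_measure_shift (t : R) (A : set R) : measurable A ->
  leb ((fun x => x + t) @^-1` A) = leb A.
Proof.
have mt : measurable_fun [set: measurableTypeR R]
    (fun x : R => x + t : measurableTypeR R) by exact: measurable_funD.
move=> mA; apply/esym.
apply: (lebesgue_measure_unique (mu := image_measure leb mt)) => //.
move=> _ [[a b] _ <-]; rewrite /= /pushforward.
have -> : (fun x : R => x + t) @^-1` `]a, b] = `](a - t), (b - t)]%classic.
  by apply/seteqP; split => x /=; rewrite !in_itv/= ltrBlDr lerBrDr.
by rewrite !lebesgue_measure_itv/= !lte_fin ltrD2r !EFinN -!EFinD opprB addrA subrK.
Qed.

Definition frac (u : R) : R := u - (Num.floor u)%:~R.

Lemma measurable_frac : measurable_fun setT frac.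
Proof.
apply: measurable_funB => //; apply: nondecreasing_measurable => //.
by move=> x y xy; rewrite ler_int le_floor.
Qed.

Lemma uniform01E (A : set R) : measurable A -> uniform01 A = leb (A `&` `[0, 1[).
Proof.
move=> mA; rewrite /uniform01 /uniform_prob integral_uniform_pdf.
transitivity (leb (A `&` `[0, 1]%classic)).
  rewrite (eq_integral (fun=> 1%E)); last first.
    move=> x /[!inE] -[_]; rewrite /= in_itv/= /uniform_pdf => ->.
    by rewrite subr0 invr1.
  by rewrite integral_cst ?mul1e//; apply: measurableI.
have -> : A `&` `[0, 1]%classic = (A `&` `[0, 1[) `|` (A `&` [set 1]).
  by rewrite -setIUr setUitv1// bnd_simp.
rewrite measureU//; last 3 first.
- exact: measurableI.
- exact: measurableI.
- rewrite setIACA setIid (_ : _ `&` [set 1] = set0) ?setI0//.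
  by apply/seteqP; split=> x //= [+ x1]; rewrite in_itv/= x1 ltxx andbF.
rewrite [X in (_ + X)%E](_ : _ = 0%E) ?adde0//.
apply/eqP; rewrite -measure_le0 -(lebesgue_measure_set1 (1 : R)).
by apply: le_measure; rewrite ?inE//; apply: measurableI.
Qed.

Lemma frac_floorE (u : R) : u = frac u + (Num.floor u)%:~R.
Proof. by rewrite subrK. Qed.

Lemma frac_id (u : R) : 0 <= u < 1 -> frac u = u.
Proof. by move=> u01; rewrite /frac (floor_def (m := 0)) ?subr0// add0r. Qed.

Lemma frac_itv (u : R) : 0 <= frac u < 1.
Proof.
have /andP[] := floor_itv u; rewrite intrD1 => h1 h2.
by rewrite subr_ge0 h1 ltrBlDl.
Qed.

Lemma fracDz (u : R) (k : int) : frac (u + k%:~R) = frac u.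
Proof. by rewrite /frac floorDrz ?intrKfloor ?intr_int// intrD opprD addrACA subrr addr0. Qed.

(** Cut the unit interval at the point that the shift carries to 1 and move each
    of the two pieces back by a translation: the interval is only rearranged. *)
Lemma uniform01_frac_shift (c : R) (A : set R) : measurable A ->
  uniform01 ((fun u => frac (u + c)) @^-1` A) = uniform01 A.
Proof.
move=> mA.
(* Reduce to a shift in [0, 1[. *)
have -> : (fun u => frac (u + c)) = (fun u => frac (u + frac c)).
  by apply/funext => u; rewrite {1}(frac_floorE c) addrA fracDz.
have /andP[] := frac_itv c; move: (frac c) => {}c c0 c1.
have mp (D : set R) (x : R) : measurable D -> measurable ((fun u => u + x) @^-1` D).
  by move=> mD; rewrite -[_ @^-1` _]setTI; exact: measurable_funD.
rewrite !uniform01E//; last first.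
  rewrite -[_ @^-1` _]setTI.
  by apply: (measurableT_comp measurable_frac) => //; exact: measurable_funD.
have -> : (fun u => frac (u + c)) @^-1` A `&` `[0, 1[ =
   ((fun u => u + c) @^-1` (A `&` `[c, 1[)) `|`
   ((fun u => u + (c - 1)) @^-1` (A `&` `[0, c[)).
  apply/seteqP; split => u /=; rewrite !in_itv/=.
    move=> [+ /andP[u0 u1]]; have [uc1|uc1] := ltP (u + c) 1.
      by rewrite frac_id; [move=> Au; left; split => //; lra | lra].
    rewrite -(fracDz _ (-1)) mulrN1z -addrA frac_id; last by lra.
    by move=> Au; right; split => //; lra.
  move=> [[Au uc]|[Au uc]]; split; try lra.
    by rewrite frac_id//; lra.
  by rewrite -(fracDz _ (-1)) mulrN1z -addrA frac_id//; lra.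
rewrite measureU; last 3 first.
- by apply: mp; exact: measurableI.
- by apply: mp; exact: measurableI.
- by apply/seteqP; split => u //=; rewrite !in_itv/=; lra.
transitivity (leb (A `&` `[c, 1[)%R + leb (A `&` `[0, c[)%R)%E.
  by congr (_ + _)%E; apply: lebesgue_measure_shift; exact: measurableI.
rewrite -measureU; last 3 first.
- exact: measurableI.
- exact: measurableI.
- by apply/seteqP; split => u //=; rewrite !in_itv/=; lra.
congr leb; rewrite -setIUr; congr (_ `&` _).
by apply/seteqP; split => u /=; rewrite !in_itv/=; lra.
Qed.

End uniform_shift.

(** * The limiting point process *)

(** On each half line, inversion is up to sign the real power of exponent -1;
    both are 0 at 0. *)
Lemma measurable_invr (R : realType) : measurable_fun setT (fun x : R => x^-1).
Proof.
have -> : (fun x : R => x^-1) =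
    (fun x : R => if 0 <= x then x `^ (-1) else - ((- x) `^ (-1))).
  apply/funext => x; case: (leP 0 x) => x0; first by rewrite powR_inv1.
  by rewrite powR_inv1 ?oppr_ge0 ?ltW// invrN opprK.
apply: measurable_fun_ifT.
- by apply: measurable_fun_ler.
- exact: measurable_powR.
- have mp := @measurable_powR R (-1).
  apply: measurable_funN; apply: (measurableT_comp mp).
  exact: oppr_measurable.
Qed.

Lemma measurable_countable_esum d (T : measurableType d) (R : realType)
    (I : countType) (f : I -> T -> \bar R) :
  (forall i, measurable_fun setT (f i)) -> (forall i w, (0 <= f i w)%E) ->
  measurable_fun setT (fun w => \esum_(i in [set: I]) f i w).
Proof.
move=> mf f0.
pose a n w : \bar R := if n \in (@choice.pickle I @` setT)
  then oapp (f^~ w) 0%E (choice.unpickle n) else 0%E.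
have a0 n w : (0 <= a n w)%E.
  by rewrite /a; case: ifP => // _; case: (choice.unpickle n) => //= i; exact: f0.
have -> : (fun w => \esum_(i in setT) f i w) =
    (fun w => \sum_(0 <= n <oo) a n w)%E.
  apply/funext => w; rewrite nneseries_esumT//.
  rewrite -(esum_mkcond _ (fun n => oapp (f^~ w) 0%E (choice.unpickle n))) esum_image.
    by apply: eq_esum => i _; rewrite choice.pickleK.
  by move=> i j _ _; exact: (pcan_inj choice.pickleK).
apply: ge0_emeasurable_sum => n; rewrite /a.
- by move=> w _ _; exact: a0.
- by move=> _; case: (n \in _) => //; case: (choice.unpickle n).
Qed.

Section tau_infty.
Variable R : realType.

Lemma measurable_rseq_coordinate (m : nat) :
  measurable_fun setT (fun x : rseq R => x m).
Proof.
exact: (@measurable_coordinate _ (rseq R) nat _ (fun=> R) setT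
  (fun m (x : rseq R) => x m) m erefl).
Qed.

Lemma measurable_to_rseq d (T : measurableType d) (f : T -> rseq R) :
  (forall m, measurable_fun setT (fun w => f w m)) -> measurable_fun setT f.
Proof.
move=> mf.
apply: (@measurable_to_generated _ T _ (rseq R) nat _ (fun=> R) setT
  (fun m (x : rseq R) => x m) f erefl) => m _.
exact: mf.
Qed.

Lemma measurable_tau_infty :
  measurable_fun setT (fun p : rseq R * rseq R => tau_infty p.1 p.2).
Proof.
apply: measurable_to_measures => B mB; rewrite /tau_infty /= /point_measure.
apply: (measurable_countable_esum (I := (nat * int)%type)) => [[m k]|[m k] w] /=; last first.
  by rewrite mul1e diracE lee_fin ler0n.
apply: emeasurable_funM => //.
apply: (measurableT_comp (measurable_fun_dirac (D := setT) mB)).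
apply: measurable_funM.
  apply: measurable_funD => //.
  exact: (measurableT_comp (measurable_rseq_coordinate m) measurable_snd).
apply: (measurableT_comp (@measurable_invr R)).
exact: (measurableT_comp (measurable_rseq_coordinate m) measurable_fst).
Qed.

(** The phases of the point process translated by [t]: moving every point
    [(k + chi m) / x m] by [t] moves its numerator by [t * x m], and the integer
    part of the new phase can be absorbed in [k]. *)
Definition shift_phases (t : R) (x chi : rseq R) : rseq R :=
  fun m => frac (chi m + t * x m).

Lemma measurable_shift_phases (t : R) :
  measurable_fun setT (fun p : rseq R * rseq R => shift_phases t p.1 p.2).
Proof.
apply: measurable_to_rseq => m; apply: (measurableT_comp (@measurable_frac R)).
apply: measurable_funD => /=.
  exact: (measurableT_comp (measurable_rseq_coordinate m) measurable_snd).
apply: measurable_funM => //.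
exact: (measurableT_comp (measurable_rseq_coordinate m) measurable_fst).
Qed.

(** For each [m] the two measures have the same atoms, up to the renumbering of
    [k] by the integer part of the shifted phase. *)
Lemma translate_tau_infty (t : R) (x chi : rseq R) : (forall m, x m != 0) ->
  translate t (tau_infty x chi) = tau_infty x (shift_phases t x chi) :> measures R.
Proof.
move=> x0; apply: eq_measure; apply/funext => B.
rewrite /= /translate /pushforward /tau_infty /= /point_measure.
pose e (mk : nat * int) := (mk.1, mk.2 + Num.floor (chi mk.1 + t * x mk.1)).
rewrite [RHS](reindex_esum setT _ e); last first.
  split => // [[m k] [m' k'] _ _ [<-] /addIr -> //|[m k] _].
  by exists (m, k - Num.floor (chi m + t * x m)); rewrite //= /e /= subrK.
apply: eq_esum => -[m k] _ /=; congr (_ * _)%E; rewrite !diracE /=.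
suff -> : ((k + Num.floor (chi m + t * x m))%:~R + shift_phases t x chi m) / x m =
    (k%:~R + chi m) / x m + t by congr (_%:R%:E); apply/idP/idP; rewrite !inE.
rewrite intrD -addrA [X in _ + X]addrC -frac_floorE addrA mulrDl mulfK//.
Qed.

End tau_infty.

(** * Translation invariance of the limiting process *)

Section limit_law.
Context (R : realType) d (Omega : measurableType d) (P : probability Omega R).

Lemma rseq_measurableE : @measurable _ (rseq R) =
  <<s \bigcup_(m in [set: nat])
     preimage_set_system setT (fun x : rseq R => x m) measurable >>.
Proof. by []. Qed.

(** The shift is by a deterministic sequence, so on a cylinder it acts on each
    factor of a product of uniform laws separately. *)
Lemma iid_uniform01_shift (chi : {RV P >-> rseq R}) (c : rseq R) :
  iid chi (@uniform01 R) -> forall A, measurable A ->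
  distribution P chi ((fun b : rseq R => (fun m => frac (b m + c m)) : rseq R) @^-1` A) =
  distribution P chi A.
Proof.
move=> [indep unif].
have mc : measurable_fun [set: rseq R]
    (fun b : rseq R => (fun m => frac (b m + c m)) : rseq R).
  apply: measurable_to_rseq => m; apply: (measurableT_comp (@measurable_frac R)).
  by apply: measurable_funD => //; exact: measurable_rseq_coordinate.
pose mu := image_measure (distribution P chi) mc.
have cylE (B : nat -> set R) (J : seq nat) : (forall i, measurable (B i)) ->
    distribution P chi (cylinder (fun m (b : rseq R) => b m) J B) =
    (\prod_(i <- [fset j | j in J]%fset) uniform01 (B i))%E.
  move=> mB; have := indep [fset j | j in J]%fset
    (fun m => (fun w => chi w m) @^-1` B m).
  rewrite /distribution /pushforward => indepB.
  rewrite -(eq_bigr _ (fun i _ => unif i (B i) (mB i))) -indepB; last first.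
    by move=> i _; exists (B i) => //; rewrite setTI.
  congr (P _); apply/seteqP; split => w wB i /=.
    by move=> /imfsetP[j jJ ->]; exact: wB.
  by move=> iJ; apply: wB => /=; apply/imfsetP; exists i.
apply: (cylinder_measure_unique (m1 := mu) rseq_measurableE) => [|J B mB].
  by rewrite /= /pushforward preimage_setT probability_setT ltry.
rewrite /= [LHS](_ : _ = distribution P chi (cylinder (fun m (b : rseq R) => b m) J
   (fun m => (fun u => frac (u + c m)) @^-1` B m))) //.
rewrite !cylE//.
  apply: eq_bigr => i _; exact: uniform01_frac_shift.
move=> i; rewrite -[_ @^-1` _]setTI; apply: (measurableT_comp (@measurable_frac R)) => //.
exact: measurable_funD.
Qed.

(** Independence makes the joint law a product measure.  By Fubini it suffices
    to freeze [x], and the shift of the phases is then deterministic. *)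
Lemma joint_law_shift_phases (x chi : {RV P >-> rseq R}) (t : R) :
  iid chi (@uniform01 R) -> independent x chi ->
  forall E, measurable E ->
  P ((fun w => (x w, shift_phases t (x w) (chi w))) @^-1` E) =
  P ((fun w => (x w, chi w)) @^-1` E).
Proof.
move=> chiU xchi E mE.
have mxchi : measurable_fun setT (fun w => (x w, chi w)).
  by apply/measurable_fun_pairP; split => /=; exact: measurable_funPT.
have prodE F : measurable F ->
    P ((fun w => (x w, chi w)) @^-1` F) =
    (distribution P x \x distribution P chi)%E F.
  move=> mF; rewrite (product_measure_unique (m' := image_measure P mxchi))//.
pose S (p : rseq R * rseq R) := (p.1, shift_phases t p.1 p.2).
have mS : measurable_fun setT S.
  apply/measurable_fun_pairP; split => /=; first exact: measurable_fst.
  exact: (@measurable_shift_phases R t).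
rewrite [LHS](prodE (S @^-1` E)); last by rewrite -[_ @^-1` _]setTI; exact: mS.
rewrite prodE//; apply: eq_integral => a _ /=.
rewrite -[RHS](iid_uniform01_shift (fun m => t * a m) chiU (measurable_xsection a mE)).
by congr (distribution P chi _).
Qed.

(** The law of the sticks charges only the open unit interval, so almost surely
    every GEM weight is a product of positive numbers; the decreasing
    rearrangement only permutes the weights. *)
Lemma poisson_dirichlet_neq0 (theta : R) (x : {RV P >-> rseq R}) :
  is_poisson_dirichlet theta x -> P (x @^-1` [set a | exists m, a m = 0]) = 0%E.
Proof.
case=> dd [OO] [P'] [y] [x'] [] [V] [[_ Vlaw] yE] xy xx'.
have mZ : measurable [set a : rseq R | exists m, a m = 0].
  rewrite (_ : [set _ | _] = \bigcup_m ((fun a : rseq R => a m) @^-1` [set 0])).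
    apply: bigcup_measurable => m _; rewrite -[_ @^-1` _]setTI.
    exact: measurable_rseq_coordinate.
  by apply/seteqP; split => a /= [m]; [exists m | exists m].
rewrite [LHS](xx' _ mZ) /distribution /pushforward; apply: measure_negligible.
  by rewrite -[_ @^-1` _]setTI; exact: measurable_funPT.
have mV m : measurable_fun setT (fun w => V w m).
  exact: (measurableT_comp (measurable_rseq_coordinate m) (measurable_funPT V)).
pose bad m := (fun w => V w m) @^-1` ~` `]0, 1[.
have mbad m : measurable (bad m).
  by rewrite -[bad m]setTI; apply: mV => //; exact: measurableC.
have bad0 m : P' (bad m) = 0%E.
  transitivity (gem_stick_law theta (~` `]0, 1[)).
    by apply: Vlaw; exact: measurableC.
  by rewrite /gem_stick_law setICl integral_set0.
suff : P'.-negligible (~` [set w | decreasing_rearrangement (y w) (x' w)] `|`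
    \bigcup_m bad m).
  apply: negligibleS.
  move=> w [m x'm0]; apply: contrapT => /not_orP[/contrapT[_ [f [_ x'y]]] Vgood].
  have V01 i : 0 < V w i < 1.
    apply/negPn/negP => Vi; apply: Vgood; exists i => //=.
    by rewrite /bad /= in_itv/=; exact/negP.
  have : y w (f m) > 0.
    rewrite yE mulr_gt0 ?(andP (V01 _)).1// prodr_gt0// => i _.
    by rewrite subr_gt0; have /andP[] := V01 i.
  by rewrite -x'y x'm0 ltxx.
apply: negligibleU; first exact: xy.
apply: negligible_bigcup => m; by exists (bad m); split; [exact: mbad|exact: bad0|].
Qed.

(** Outside the null event where some weight vanishes, translating the point
    process amounts to shifting the phases, which preserves the joint law. *)
Lemma tau_infty_translation_invariant (theta : R) (x chi : {RV P >-> rseq R}) :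
  is_poisson_dirichlet theta x -> iid chi (@uniform01 R) -> independent x chi ->
  translation_invariant_law P (fun w => tau_infty (x w) (chi w)).
Proof.
move=> xPD chiU xchi t A mA.
have mxchi : measurable_fun setT (fun w => (x w, chi w)).
  by apply/measurable_fun_pairP; split => /=; exact: measurable_funPT.
pose E := (fun p : rseq R * rseq R => tau_infty p.1 p.2) @^-1` A.
have mE : measurable E by rewrite -[E]setTI; exact: measurable_tau_infty.
have mxS : measurable_fun setT (fun w => (x w, shift_phases t (x w) (chi w))).
  apply/measurable_fun_pairP; split => /=; first exact: measurable_funPT.
  exact: (measurableT_comp (measurable_shift_phases t) mxchi).
have mZ : measurable (x @^-1` [set a | exists m, a m = 0]).
  rewrite (_ : _ @^-1` _ = \bigcup_m ((fun w => x w m) @^-1` [set 0])).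
    apply: bigcup_measurable => m _; rewrite -[_ @^-1` _]setTI.
    exact: (measurableT_comp (measurable_rseq_coordinate m) (measurable_funPT x)).
  by apply/seteqP; split => a /= [m]; [exists m | exists m].
rewrite /pushforward -[RHS](joint_law_shift_phases t chiU xchi mE).
set L := (X in P X = _); set L' := (X in _ = P X).
have LL' : L `\` (x @^-1` [set a | exists m, a m = 0]) =
          L' `\` (x @^-1` [set a | exists m, a m = 0]).
  by apply/seteqP; split => w [Lw xw]; split => //; move: Lw;
    rewrite /L /L' /E /= translate_tau_infty// => m; apply/eqP => xm;
    apply: xw; exists m.
have mL : measurable L.
  rewrite -[L]setTI.
  apply: (measurableT_comp (measurable_translate t)
    (measurableT_comp (@measurable_tau_infty R) mxchi)) => //.
have mL' : measurable L' by rewrite -[L']setTI; exact: mxS.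
have x0 := poisson_dirichlet_neq0 xPD.
have nullI K : measurable K ->
    P (K `&` x @^-1` [set a | exists m, a m = 0]) = 0%E.
  by move=> mK; apply: subset_measure0 x0 => //; exact: measurableI.
rewrite (measureDI P mL mZ) (measureDI P mL' mZ) LL'.
congr (_ + _)%E; by transitivity (0%E : \bar R); [exact: nullI | apply/esym; exact: nullI].
Qed.

End limit_law.

(** * Rotation invariance of the random matrices *)

Section complex_valued.
Variable R : realType.
Implicit Types (x y : R) (z : R[i]).

Lemma expiD x y : expi (x + y) = expi x * expi y.
Proof.
by rewrite /expi cosD sinD; apply/eqP; rewrite eq_complex/= [sin x * cos y + _]addrC !eqxx.
Qed.

Lemma expi2piz (k : int) : expi (2 * pi * k%:~R : R) = 1.
Proof.
have expi0 : expi 0 = 1 :> R[i] by rewrite /expi cos0 sin0.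
have expin n : expi (2 * pi * n%:R : R) = 1.
  have -> : 2 * pi * n%:R = 0 + (pi *+ 2) *+ n :> R.
    by rewrite add0r -[RHS]mulr_natr -[pi *+ 2]mulr_natl.
  by rewrite /expi (periodicn (@cosD2pi R)) (periodicn (@sinD2pi R)).
case: k => n; first exact: expin.
have := expiD (2 * pi * n.+1%:R) (2 * pi * (Negz n)%:~R).
by rewrite expin mul1r -mulrDr NegzE mulrNz subrr mulr0 expi0.
Qed.

Lemma expi_frac x : expi (2 * pi * frac x) = expi (2 * pi * x).
Proof. by rewrite [in RHS](frac_floorE x) [in RHS]mulrDr [in RHS]expiD expi2piz mulr1. Qed.

Lemma measurable_Re : measurable_fun setT (@complex.Re R).
Proof.
move=> _ B mB; apply: sub_sigma_algebra; left; by exists B.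
Qed.

Lemma measurable_Im : measurable_fun setT (@complex.Im R).
Proof.
move=> _ B mB; apply: sub_sigma_algebra; right; by exists B.
Qed.

Lemma measurable_complexP d (T : measurableType d) (f : T -> R[i]) :
  measurable_fun setT f <->
  measurable_fun setT (fun w => complex.Re (f w)) /\
  measurable_fun setT (fun w => complex.Im (f w)).
Proof.
split=> [mf|[mRe mIm]].
  by split; [exact: (measurableT_comp measurable_Re)|exact: (measurableT_comp measurable_Im)].
apply: (measurability (preimage_set_system setT (@complex.Re R) measurable `|`
  preimage_set_system setT (@complex.Im R) measurable)) => //.
move=> _ [_ [[B mB <-]|[B mB <-]] <-]; rewrite !setTI -[_ @^-1` _]setTI.
  exact: mRe.
exact: mIm.
Qed.

Lemma measurable_mulc z : measurable_fun setT (fun z' : R[i] => z * z').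
Proof.
apply/measurable_complexP; case: z => a b; split.
  rewrite (_ : (fun _ => _) = fun z' => a * complex.Re z' - b * complex.Im z');
    last by apply/funext => -[].
  apply: measurable_funB; apply: measurable_funM => //;
    [exact: measurable_Re|exact: measurable_Im].
rewrite (_ : (fun _ => _) = fun z' => a * complex.Im z' + b * complex.Re z');
    last by apply/funext => -[].
apply: measurable_funD; apply: measurable_funM => //;
    [exact: measurable_Im|exact: measurable_Re].
Qed.

Lemma measurable_expi2pi : measurable_fun setT (fun u : R => expi (2 * pi * u)).
Proof.
have m2 : measurable_fun setT (fun u : R => 2 * pi * u) by exact: measurable_funM.
apply/measurable_complexP; split => /=.
  apply: (measurableT_comp (f := @cos R)) => //.
  apply: continuous_measurable_fun; exact: continuous_cos.
apply: (measurableT_comp (f := @sin R)) => //.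
apply: continuous_measurable_fun; exact: continuous_sin.
Qed.

(** In the angular coordinate a rotation is a shift modulo 1. *)
Lemma uniform_circle_rotation (c : R) (C : set R[i]) : measurable C ->
  uniform_circle ((fun z => expi (2 * pi * c) * z) @^-1` C) = uniform_circle C.
Proof.
move=> mC; rewrite /uniform_circle /pushforward.
pose A := (fun u : R => expi (2 * pi * u)) @^-1` C.
have mA : measurable A by rewrite -[A]setTI; exact: measurable_expi2pi.
rewrite -[RHS](uniform01_frac_shift c mA); congr uniform01.
have cE u : expi (2 * pi * (u + c)) = expi (2 * pi * c) * expi (2 * pi * u).
  by rewrite mulrDr expiD mulrC.
by apply/seteqP; split => u; rewrite /A /= expi_frac cE.
Qed.
End complex_valued.

Section matrix_law.
Context (R : realType) (N : nat).

Lemma matrix_measurableE : @measurable _ 'M[R[i]]_N =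
  <<s \bigcup_(ij in [set: 'I_N * 'I_N])
     preimage_set_system setT (fun M : 'M[R[i]]_N => M ij.1 ij.2) measurable >>.
Proof. by []. Qed.

Context d (Omega : measurableType d) (P : probability Omega R).
Variables (s : {RV P >-> 'S_N}) (z : 'I_N -> {RV P >-> R[i]}).
Hypothesis zU : forall j, eq_law (distribution P (z j)) (@uniform_circle R).
Hypothesis indep : mutually_independent P (fun o : option 'I_N =>
  if o is Some j then g_sigma_algebra_preimage (z j)
  else g_sigma_algebra_preimage s).

(** On the event that the permutation is a given [s0], the matrix is a fixed
    function of the independent entries [z j]; on a cylinder of matrices the
    probability factorizes over [j] and each factor is rotation invariant. *)
Lemma perm_matrix_rotation_law (c : R) (E : set 'M[R[i]]_N) : measurable E ->
  P ((fun w => perm_matrix (s w) (fun j => expi (2 * pi * c) * z j w)) @^-1` E) =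
  P ((fun w => perm_matrix (s w) (fun j => z j w)) @^-1` E).
Proof.
move=> mE.
have ms0 (s0 : 'S_N) : measurable (s @^-1` [set s0]).
  by rewrite -[_ @^-1` _]setTI; exact: measurable_funPT.
have mM (s0 : 'S_N) (f : R[i] -> R[i]) : measurable_fun setT f ->
    measurable_fun setT (fun w => perm_matrix s0 (fun j => f (z j w)) : 'M[R[i]]_N).
  move=> mf; apply: (measurable_to_generated matrix_measurableE) => -[j k] _ /=.
  rewrite (_ : _ \o _ = if j == s0 k then f \o z j else cst 0).
    by case: ifP => // _; apply: measurableT_comp mf _; exact: measurable_funPT.
  by apply/funext => w /=; rewrite mxE; case: ifP.
pose C (B : 'I_N * 'I_N -> set R[i]) (J : seq ('I_N * 'I_N)) (s0 : 'S_N) j :=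
   [set u : R[i] | forall k, (j, k) \in J -> B (j, k) (if j == s0 k then u else 0)].
have mC B J s0 j : (forall i, measurable (B i)) -> measurable (C B J s0 j).
  move=> mB.
  rewrite (_ : C _ _ _ _ = \bigcap_(k in [set k | (j, k) \in J])
     ((fun u => if j == s0 k then u else 0) @^-1` B (j, k))); last by [].
  apply: fin_bigcap_measurable => [|k _]; first exact: finite_finset.
  have mif : measurable_fun setT (fun u : R[i] => if j == s0 k then u else 0).
    by case: (j == s0 k).
  by rewrite -[_ @^-1` _]setTI; exact: mif.
have cylE (s0 : 'S_N) (f : R[i] -> R[i]) J B : measurable_fun setT f ->
    (forall i, measurable (B i)) ->
    P ((fun w => perm_matrix s0 (fun j => f (z j w))) @^-1`
        cylinder (fun ij (M : 'M[R[i]]_N) => M ij.1 ij.2) J B `&` s @^-1` [set s0]) =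
    (\prod_(o <- [fset o in enum {: option 'I_N}]%fset)
      if o is Some j then uniform_circle (f @^-1` C B J s0 j)
      else P (s @^-1` [set s0]))%E.
  move=> mf mB.
  pose A (o : option 'I_N) := if o is Some j then z j @^-1` (f @^-1` C B J s0 j)
                            else s @^-1` [set s0].
  have mfC j : measurable (f @^-1` C B J s0 j).
    by rewrite -[_ @^-1` _]setTI; apply: mf => //; exact: mC.
  transitivity (\prod_(o <- [fset o in enum {: option 'I_N}]%fset) P (A o))%E; last first.
    by apply: eq_bigr => -[j|] _ //=; exact: zU.
  rewrite -indep; last first.
    by move=> [j|] _ /=; [exists (f @^-1` C B J s0 j)|exists [set s0]]; rewrite ?setTI.
  congr (P _); apply/seteqP; split => w.
    move=> [wB ws] [j|] _ //= k jk.
    by have := wB _ jk; rewrite /= mxE.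
  move=> wA; split.
    move=> [j k] jk /=; rewrite mxE.
    apply: (wA (Some j)) jk => /=.
    by apply/imfsetP; exists (Some j) => //=; rewrite mem_enum.
  by apply: (wA None) => /=; apply/imfsetP; exists None => //=; rewrite mem_enum.
have splitE (f : R[i] -> R[i]) : measurable_fun setT f ->
    P ((fun w => perm_matrix (s w) (fun j => f (z j w))) @^-1` E) =
    (\sum_(s0 \in [set: 'S_N]) P ((fun w => perm_matrix s0 (fun j => f (z j w))) @^-1` E
        `&` s @^-1` [set s0]))%E.
  move=> mf; rewrite -measure_fin_bigcup//.
  - congr (P _); apply/seteqP; split => w /=; first by exists (s w).
    by move=> [s0 _ [Ew /= ws]]; rewrite ws.
  - exact: finite_finset.
  - by move=> s1 s2 _ _ [w [[_ /= ws1] [_ /= ws2]]]; rewrite -ws1 -ws2.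
  - move=> s0 _; apply: measurableI; last exact: ms0.
    by rewrite -[_ @^-1` _]setTI; exact: mM.
rewrite (splitE (fun u => expi (2 * pi * c) * u)); last exact: measurable_mulc.
rewrite (splitE id)//; apply: eq_fsbigr => s0 _.
pose m0 := mrestr P (ms0 s0).
pose m1 := image_measure m0 (mM s0 _ (measurable_mulc (expi (2 * pi * c)))).
pose m2 := image_measure m0 (mM s0 id (@measurable_id _ _ _)).
apply: (cylinder_measure_unique (m1 := m1) (m2 := m2) matrix_measurableE) mE.
  rewrite /= /pushforward /mrestr preimage_setT setTI.
  by apply: le_lt_trans (probability_le1 _ _) _ => //; rewrite ltry.
move=> J B mB; rewrite [LHS](cylE s0 _ J B (measurable_mulc _) mB).
rewrite [RHS](cylE s0 id J B _ mB)//; apply: eq_bigr => -[j|] _ //.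
by apply: uniform_circle_rotation; exact: mC.
Qed.

End matrix_law.

(** * Measurability of random point measures *)

Section zero_hitting.
Context d (T : measurableType d) (R : realType) (F : T -> R -> R).
Hypothesis F_ge0 : forall w x, 0 <= F w x.
Hypothesis mF : forall x, measurable_fun setT (F ^~ x).
Hypothesis cF : forall w, continuous (F w).

(** By compactness, a nonnegative continuous function has a zero in a closed
    interval as soon as its values at rational points come arbitrarily close to
    0, and this is a countable condition. *)
Lemma measurable_zero_hitting (a b : R) :
  measurable [set w | exists2 x, a < x < b & F w x = 0].
Proof.
pose small (r : rat) n := [set w | F w (ratr r) < n.+1%:R^-1].
pose near0 (p q : rat) := \bigcap_n \bigcup_(r in [set r | p < r < q]) small r n.
have -> : [set w | exists2 x, a < x < b & F w x = 0] =
    \bigcup_p \bigcup_q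
      (if (p < q) && (a < ratr p) && (ratr q < b) then near0 p q else set0).
  apply/seteqP; split => w.
    move=> [x /andP[ax xb] Fx0].
    have [p] := rat_in_itvoo ax; rewrite in_itv/= => /andP[ap px].
    have [q] := rat_in_itvoo xb; rewrite in_itv/= => /andP[xq qb].
    exists p => //; exists q => //.
    have pq : p < q by rewrite -(ltr_rat R) (lt_trans px).
    rewrite pq ap qb /= => n _.
    have n0 : (0 : R) < n.+1%:R^-1 by rewrite invr_gt0.
    have /cvgrPdist_lt/(_ _ n0) := @cF w x.
    rewrite Fx0 => /nbhs_ballP[e /= e0 He].
    have pe : Num.max (ratr p) (x - e) < Num.min (ratr q) (x + e).
      by rewrite lt_min !gt_max; apply/andP; split; apply/andP; split; lra.
    have [r] := rat_in_itvoo pe.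
    rewrite in_itv/= gt_max lt_min => /andP[/andP[pr xr] /andP[rq rx]].
    exists r; first by rewrite /= -!(ltr_rat R) pr.
    have := He (ratr r); rewrite /= sub0r normrN ger0_norm//; apply.
    by rewrite /ball /= ltr_norml; lra.
  move=> [p _] [q _]; case: ifP => // /andP[/andP[pq ap] qb] wpq.
  have pq' : ratr p <= ratr q :> R by rewrite ler_rat ltW.
  have cFw : {within `[ratr p, ratr q], continuous (F w)}.
    exact: continuous_subspaceT.
  have [c] := EVT_min pq' cFw.
  rewrite in_itv/= => /andP[pc cq] Fc.
  exists c; first by rewrite (lt_le_trans ap pc) (le_lt_trans cq qb).
  apply/eqP; rewrite eq_le F_ge0 andbT leNgt; apply/negP => Fc0.
  have [r /= /andP[pr rq]] := wpq (Num.truncn (F w c)^-1) I.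
  rewrite /small /= => Fr.
  have : F w c <= F w (ratr r) by apply: Fc; rewrite in_itv/= !ler_rat !ltW.
  move=> /le_lt_trans/(_ Fr); apply/negP; rewrite -leNgt.
  rewrite invf_ple ?posrE//; apply/ltW; exact: truncnS_gt.
apply: bigcupT_measurable_rat => p; apply: bigcupT_measurable_rat => q.
case: ifP => // _; apply: bigcapT_measurable => n.
rewrite bigcup_mkcond; apply: bigcupT_measurable_rat => r; case: ifP => // _.
rewrite /small -[X in measurable X]setTI.
by apply: measurable_fun_ltr => //.
Qed.
End zero_hitting.

Section interval_counts.
Context d (T : measurableType d) (R : realType) (c : T -> R -> nat).
Hypothesis mhit : forall k a b,
  measurable [set w | exists2 x, a < x < b & (k <= c w x)%N].

(** A certificate, ranging over a countable type, that the total weight of [m] on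
    ]a, b[ is at least the sum of the numbers listed in [l]. *)
Fixpoint hits (m : R -> nat) (a b : R) (l : seq (rat * nat)) : Prop :=
  if l is (q, k) :: l' then
    ratr q <= b /\ (exists2 x, a < x < ratr q & (k <= m x)%N) /\ hits m (ratr q) b l'
  else True.

Lemma measurable_hits a b l : measurable [set w | hits (c w) a b l].
Proof.
elim: l a => [|[q k] l IH] a /=; first exact: measurableT.
have [qb|qb] := boolP (ratr q <= b); last first.
  by rewrite (_ : [set _ | _] = set0) //; apply/seteqP; split => // w [].
rewrite (_ : [set _ | _] = [set w | exists2 x, a < x < ratr q & (k <= c w x)%N] `&`
   [set w | hits (c w) (ratr q) b l]); first exact: measurableI.
by apply/seteqP; split => w [] // [].
Qed.

Lemma hits_points (m : R -> nat) a b l : hits m a b l ->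
  exists s : seq R, [/\ path <%R a s, all (< b) s &
    (\sum_(qk <- l) qk.2 <= \sum_(x <- s) m x)%N].
Proof.
elim: l a => [|[q k] l IH] a /=; first by exists [::]; rewrite !big_nil.
move=> [qb [[x /andP[ax xq] kx] /IH[s [ps bs ls]]]].
exists (x :: s); split => /=.
- rewrite ax /=; case: s ps {bs ls} => //= y s /andP[qy ->].
  by rewrite (lt_trans xq).
- by rewrite (lt_le_trans xq qb).
- by rewrite !big_cons leq_add.
Qed.

(** Rationals separate the finitely many points of an increasing list. *)
Lemma points_hits (m : R -> nat) a b s : path <%R a s -> all (< b) s ->
  exists2 l, hits m a b l & (\sum_(qk <- l) qk.2 = \sum_(x <- s) m x)%N.
Proof.
elim: s a => [|x s IH] a /=; first by exists [::] => //; rewrite !big_nil.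
move=> /andP[ax ps] /andP[xb bs].
(* The next separating rational lies before the next point, or before b after
   the last one. *)
have xy : x < head b s by case: s ps {IH bs} => //= y s /andP[].
have [q] := rat_in_itvoo xy; rewrite in_itv/= => /andP[xq qy].
have [|l hl ls] := IH (ratr q) _ bs.
  by case: s ps qy {IH bs xy} => //= y s /andP[_ ->] ->.
exists ((q, m x) :: l); last by rewrite !big_cons ls.
split; last by split => //; exists x => //; rewrite ax.
by rewrite ltW//; case: s bs qy {ps IH xy hl ls} => //= y s /andP[yb _] /lt_trans; apply.
Qed.

(** The sum is a supremum over finite sets of points, and a finite set can be
    separated by rationals; the certificates range over a countable type. *)
Lemma esum_itv_gtP (m : R -> nat) (a b r : R) :
  (r%:E < \esum_(x in `]a, b[) (m x)%:R%:E)%E <->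
  exists2 l, hits m a b l & r < (\sum_(qk <- l) qk.2)%:R.
Proof.
pose f x : \bar R := (m x)%:R%:E.
have sumE (X : set R) : finite_set X ->
    (\sum_(x \in X) f x)%E = (\sum_(x <- fset_set X) m x)%:R%:E.
  by move=> fX; rewrite fsbig_finite//= sumEFin natr_sum.
split.
  move=> /ereal_sup_gtP[_ [X [fX Xab] <-]]; rewrite sumE// lte_fin => rX.
  pose s := sort <=%O (fset_set X).
  have sX x : x \in s -> a < x < b.
    by rewrite mem_sort in_fset_set// inE => /Xab; rewrite /= in_itv.
  have ps : path <%R a s.
    rewrite path_min_sorted ?sort_lt_sorted ?fset_uniq//.
    by apply/allP => x /sX/andP[].
  have bs : all (< b) s by apply/allP => x /sX/andP[].
  have [l hl ls] := points_hits m ps bs.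
  exists l => //; rewrite ls; move: rX; congr (_ < _%:R).
  by apply: perm_big; rewrite perm_sym; exact: permEl (perm_sort _ _).
move=> [l /hits_points[s [ps bs ls]] rl].
apply/ereal_sup_gtP; exists (\sum_(x \in [set` s]) f x)%E.
  exists [set` s] => //; split=> [|x /= xs]; [exact: finite_seq | rewrite in_itv/=].
  rewrite (allP bs x xs : x < b) andbT.
  by move: ps; rewrite (path_sortedE lt_trans) => /andP[/allP/(_ _ xs)].
rewrite -fsbig_seq.
  by rewrite sumEFin lte_fin -natr_sum (lt_le_trans rl)// ler_nat.
by apply: (sorted_uniq lt_trans ltxx); exact: (path_sorted ps).
Qed.

Lemma measurable_esum_itv (a b : R) :
  measurable_fun setT (fun w => \esum_(x in `]a, b[) (c w x)%:R%:E : \bar R).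
Proof.
apply: (measurability _ (ErealGenOInfty.measurableE R)).
move=> _ [_ [r ->] <-]; rewrite setTI.
rewrite (_ : _ @^-1` _ = \bigcup_(l : seq (rat * nat))
   (if r < (\sum_(qk <- l) qk.2)%:R then [set w | hits (c w) a b l] else set0)).
  apply: countable_bigcupT_measurable => [|l]; first exact: countableP.
  case: ifP => // _.
  exact: measurable_hits.
apply/seteqP; split => w /=.
  rewrite in_itv/= andbT => /esum_itv_gtP[l hl rl].
  by exists l => //; rewrite rl.
move=> [l _]; case: ifP => // rl hl.
by rewrite in_itv/= andbT; apply/esum_itv_gtP; exists l.
Qed.
End interval_counts.

Section random_measure.
Context d (T : measurableType d) (R : realType) (k : T -> measures R).
Hypothesis mk_itv : forall a b, measurable_fun setT (fun w => k w `]a, b[%classic).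
Hypothesis fin_itv : forall w a b, (k w `]a, b[%classic < +oo)%E.

Let win (n : nat) : set R := `]- n%:R, n%:R[.

(** Dynkin's lemma in the windows ]-n, n[, where finiteness allows passing to
    complements, followed by the limit over the windows. *)
Lemma measurable_random_measure : measurable_fun setT k.
Proof.
have mw n : measurable (win n) by rewrite /win; exact: measurable_itv.
have mwin n (B : set R) : measurable B ->
    measurable_fun setT (fun w => k w (B `&` win n)).
  move=> mB; move: B mB.
  have RG := RGenOpens.measurableE R.
  suff H (B : set R) : <<s @RGenOpens.G R >> B ->
      measurable_fun setT (fun w => k w (B `&` win n)).
    by move=> B mB; apply: H; rewrite -[X in X B]RG.
  apply: (@dynkin_induction _ (measurableTypeR R) (@RGenOpens.G R)
    (fun B => measurable_fun setT (fun w => k w (B `&` win n)))).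
  - exact: RG.
  - move=> _ _ [a [b ->]] [a' [b' ->]].
    exists (Num.max a a'), (Num.min b b'); apply/seteqP; split => x /=;
      rewrite !in_itv/= gt_max lt_min.
      by move=> [/andP[-> ->] /andP[-> ->]].
    by move=> /andP[/andP[-> ->] /andP[-> ->]].
  - by under eq_fun do rewrite setTI; exact: mk_itv.
  - move=> _ [a [b ->]].
    rewrite (_ : `]a, b[%classic `&` win n =
        `](Num.max a (- n%:R)), (Num.min b n%:R)[%classic); first exact: mk_itv.
    apply/seteqP; split => x; rewrite /win /= !in_itv/= gt_max lt_min.
      by move=> [/andP[-> ->] /andP[-> ->]].
    by move=> /andP[/andP[-> ->] /andP[-> ->]].
  - move=> S mS PS.
    have fS w : (k w (S `&` win n) < +oo)%E.
      apply: le_lt_trans (fin_itv w (- n%:R) n%:R).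
      by apply: le_measure; rewrite ?inE//; exact: measurableI.
    rewrite (_ : (fun w => _) = (fun w => k w (win n) - k w (S `&` win n))%E).
      by apply: emeasurable_funB => //; exact: mk_itv.
    apply/funext => w; rewrite setIC [S `&` _]setIC -setDE measureD//.
    exact: fin_itv.
  - move=> F mF tF PF.
    rewrite (_ : (fun w => _) = (fun w => \sum_(0 <= i <oo) k w (F i `&` win n))%E).
      by apply: ge0_emeasurable_sum.
    apply/funext => w; rewrite setI_bigcupl measure_semi_bigcup//.
    - by move=> i; apply: measurableI => //; exact: mF.
    - exact: trivIset_setIr.
    - by apply: bigcupT_measurable => i; apply: measurableI => //; exact: mF.
apply: measurable_to_measures => B mB.
apply: (emeasurable_fun_cvg (fun n w => k w (B `&` win n))) => [n|w _].
  exact: mwin.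
have UB : B = \bigcup_n (B `&` win n).
  rewrite -setI_bigcupr (_ : \bigcup_n win n = setT) ?setIT//.
  apply/seteqP; split => // x _; exists (Num.truncn `|x|).+1 => //.
  by rewrite /win /= in_itv/= -ltr_norml truncnS_gt.
rewrite [X in _ --> k w X]UB; apply: nondecreasing_cvg_mu.
- by move=> n; exact: measurableI.
- by apply: bigcupT_measurable => n; exact: measurableI.
- move=> n m nm; apply/subsetPset; apply: setIS => x; rewrite /win /= !in_itv/=.
  by have : n%:R <= m%:R :> R by [rewrite ler_nat]; lra.
Qed.
End random_measure.

(** * Multiplicities of eigenangles *)

Section function_algebra.
Context (T : Type) (R : realType) (K : (T -> R) -> Prop).
Hypothesis K_cst : forall a, K (fun=> a).
Hypothesis KD : forall f g, K f -> K g -> K (fun w => f w + g w).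
Hypothesis KM : forall f g, K f -> K g -> K (fun w => f w * g w).

(** [K] stands for a class of real functions closed under ring operations.  It
    is used twice: for measurable functions of a matrix and for continuous
    functions of an angle. *)
Definition complex_class (f : T -> R[i]) :=
  K (fun w => complex.Re (f w)) /\ K (fun w => complex.Im (f w)).

Definition poly_class (p : T -> {poly R[i]}) :=
  forall i, complex_class (fun w => (p w)`_i).

Lemma class_sum (I : Type) (r : seq I) (f : I -> T -> R) :
  (forall i, K (f i)) -> K (fun w => \sum_(i <- r) f i w).
Proof.
move=> Kf; elim: r => [|i r IH]; first by under eq_fun do rewrite big_nil; exact: K_cst.
by under eq_fun do rewrite big_cons; exact: KD.
Qed.

Lemma complex_class_cst (z : R[i]) : complex_class (fun=> z).
Proof. by split; exact: K_cst. Qed.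

Lemma complex_classD (f g : T -> R[i]) :
  complex_class f -> complex_class g -> complex_class (fun w => f w + g w).
Proof.
move=> [fR fI] [gR gI]; split.
  under eq_fun do rewrite raddfD; exact: KD.
under eq_fun do rewrite raddfD; exact: KD.
Qed.

Lemma complex_classM (f g : T -> R[i]) :
  complex_class f -> complex_class g -> complex_class (fun w => f w * g w).
Proof.
move=> [fR fI] [gR gI]; split.
  rewrite (_ : (fun w => _) = fun w => complex.Re (f w) * complex.Re (g w) +
      (-1) * (complex.Im (f w) * complex.Im (g w))).
    by apply: KD; [exact: KM|apply: KM; [exact: K_cst|exact: KM]].
  by apply/funext => w; case: (f w) => a b; case: (g w) => a' b' /=; rewrite mulN1r.
rewrite (_ : (fun w => _) = fun w => complex.Re (f w) * complex.Im (g w) +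
      complex.Im (f w) * complex.Re (g w)).
  by apply: KD; exact: KM.
by apply/funext => w; case: (f w) => a b; case: (g w).
Qed.

Lemma complex_class_sum (I : Type) (r : seq I) (f : I -> T -> R[i]) :
  (forall i, complex_class (f i)) -> complex_class (fun w => \sum_(i <- r) f i w).
Proof.
move=> Kf; elim: r => [|i r IH].
  by under eq_fun do rewrite big_nil; exact: complex_class_cst.
by under eq_fun do rewrite big_cons; exact: complex_classD.
Qed.

Lemma poly_class_cst (p : {poly R[i]}) : poly_class (fun=> p).
Proof. by move=> i; exact: complex_class_cst. Qed.

Lemma poly_classC (f : T -> R[i]) : complex_class f -> poly_class (fun w => (f w)%:P).
Proof.
move=> Kf [|i]; under eq_fun do rewrite coefC /=; first exact: Kf.
exact: complex_class_cst.
Qed.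

Lemma poly_classD (p q : T -> {poly R[i]}) :
  poly_class p -> poly_class q -> poly_class (fun w => p w + q w).
Proof. by move=> Kp Kq i; under eq_fun do rewrite coefD; exact: complex_classD. Qed.

Lemma poly_classM (p q : T -> {poly R[i]}) :
  poly_class p -> poly_class q -> poly_class (fun w => p w * q w).
Proof.
move=> Kp Kq i; under eq_fun do rewrite coefM.
by apply: complex_class_sum => j; exact: complex_classM.
Qed.

Lemma poly_class_sum (I : Type) (r : seq I) (p : I -> T -> {poly R[i]}) :
  (forall i, poly_class (p i)) -> poly_class (fun w => \sum_(i <- r) p i w).
Proof.
move=> Kp; elim: r => [|i r IH].
  by under eq_fun do rewrite big_nil; exact: poly_class_cst.
by under eq_fun do rewrite big_cons; exact: poly_classD.
Qed.

Lemma poly_class_prod (I : Type) (r : seq I) (p : I -> T -> {poly R[i]}) :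
  (forall i, poly_class (p i)) -> poly_class (fun w => \prod_(i <- r) p i w).
Proof.
move=> Kp; elim: r => [|i r IH].
  by under eq_fun do rewrite big_nil; exact: poly_class_cst.
by under eq_fun do rewrite big_cons; exact: poly_classM.
Qed.

Lemma poly_class_exp (p : T -> {poly R[i]}) n :
  poly_class p -> poly_class (fun w => p w ^+ n).
Proof.
move=> Kp; elim: n => [|n IH]; first by under eq_fun do rewrite expr0; exact: poly_class_cst.
by under eq_fun do rewrite exprS; exact: poly_classM.
Qed.

Lemma poly_class_char_poly N (M : T -> 'M[R[i]]_N) :
  (forall i j, complex_class (fun w => M w i j)) ->
  poly_class (fun w => char_poly (M w)).
Proof.
move=> KM'; rewrite /char_poly /determinant.
apply: poly_class_sum => s; apply: poly_classM; first exact: poly_class_cst.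
apply: poly_class_prod => i; rewrite /char_poly_mx.
under eq_fun do rewrite !mxE -mulN1r.
apply: poly_classD; first exact: poly_class_cst.
apply: poly_classM; first exact: poly_class_cst.
exact: poly_classC.
Qed.

Lemma poly_class_comp_XaddC n (p : T -> {poly R[i]}) (z : T -> R[i]) :
  (forall w, size (p w) = n) -> poly_class p -> complex_class z ->
  poly_class (fun w => p w \Po ('X + (z w)%:P)).
Proof.
move=> pn Kp Kz; under eq_fun do rewrite comp_polyE pn.
apply: poly_class_sum => i; under eq_fun do rewrite -mul_polyC.
apply: poly_classM; first exact: poly_classC.
apply: poly_class_exp; apply: poly_classD; first exact: poly_class_cst.
exact: poly_classC.
Qed.
End function_algebra.

Lemma dvdXnP (F : fieldType) (q : {poly F}) k :
  ('X^k %| q) <-> forall i, (i < k)%N -> q`_i = 0.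
Proof.
split=> [/dvdpP[r ->] i ik|q0]; first by rewrite coefMXn ik.
rewrite -(poly_take_drop k q) (_ : take_poly k q = 0) ?add0r ?dvdp_mulIr//.
by apply/polyP => i; rewrite coef_take_poly coef0; case: ifP => // /q0.
Qed.

(** Substituting 'X + x for 'X moves the root to 0, where its multiplicity is
    read off the lowest coefficients. *)
Lemma mup_geqP (F : fieldType) (p : {poly F}) x k : p != 0 ->
  (k <= mup x p)%N <-> forall i, (i < k)%N -> (p \Po ('X + x%:P))`_i = 0.
Proof.
move=> p0; rewrite mup_geq// -dvdXnP.
split=> [/(dvdp_comp_poly ('X + x%:P))|/(dvdp_comp_poly ('X - x%:P))].
  by rewrite rmorphXn /= comp_polyB comp_polyX comp_polyC addrK.
rewrite rmorphXn /= comp_polyX -comp_polyA comp_polyD comp_polyX comp_polyC subrK.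
by rewrite comp_polyXr.
Qed.

Section eigenvalue_multiplicities.
Context (R : realType) (N : nat).
Implicit Type M : 'M[R[i]]_N.

Definition angle_mult M (x : R) : nat := mup (expi (2 * pi * x / N%:R)) (char_poly M).

Lemma char_poly_neq0 M : char_poly M != 0.
Proof. exact/monic_neq0/char_poly_monic. Qed.

Lemma tau_NE M (B : set R) :
  tau_N M B = \esum_(x in B) ((angle_mult M x)%:R%:E : \bar R).
Proof.
rewrite /tau_N /= /point_measure esum_mkcond [RHS]esum_mkcond.
apply: eq_esum => x _; rewrite /angle_mult.
case: ifPn => [_|]; first by rewrite diracE /=; case: (x \in B); rewrite ?mule1 ?mule0.
rewrite notin_setE /= => /negP; rewrite eigenvalue_root_char => /mupNroot ->.
by case: ifP.
Qed.

(** The sum of the squared moduli of the [k] lowest coefficients of the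
    characteristic polynomial recentred at the point of angle [x]: a function
    that is continuous in [x], measurable in [M], and that vanishes exactly when
    the multiplicity is at least [k]. *)
Definition defect M (k : nat) (x : R) : R :=
  \sum_(i < k) (complex.Re (char_poly M \Po ('X + (expi (2 * pi * x / N%:R))%:P))`_i ^+ 2 +
                complex.Im (char_poly M \Po ('X + (expi (2 * pi * x / N%:R))%:P))`_i ^+ 2).

Lemma defect_ge0 M k x : 0 <= defect M k x.
Proof. by apply: sumr_ge0 => i _; rewrite addr_ge0 ?sqr_ge0. Qed.

Lemma defect_eq0 M k x : defect M k x = 0 <-> (k <= angle_mult M x)%N.
Proof.
rewrite /angle_mult mup_geqP ?char_poly_neq0//.
set q := _ \Po _; split=> [/eqP|q0].
  rewrite psumr_eq0; last by move=> i _; rewrite addr_ge0 ?sqr_ge0.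
  move=> /allP q0 i ik; have := q0 (Ordinal ik) (mem_index_enum _).
  rewrite /= paddr_eq0 ?sqr_ge0// !sqrf_eq0 => /andP[/eqP Re0 /eqP Im0].
  by apply/eqP; rewrite eq_complex Re0 Im0 !eqxx.
by apply: big1 => i _; rewrite -/q q0//= expr0n /= addr0.
Qed.

(** The defect is obtained from the entries of the matrix and from the point of
    the circle by ring operations only, since the degree of the characteristic
    polynomial is fixed. *)
Lemma class_defect (T : Type) (K : (T -> R) -> Prop) (M : T -> 'M[R[i]]_N) (x : T -> R) k :
  (forall a, K (fun=> a)) ->
  (forall f g, K f -> K g -> K (fun w => f w + g w)) ->
  (forall f g, K f -> K g -> K (fun w => f w * g w)) ->
  (forall i j, complex_class K (fun w => M w i j)) ->
  complex_class K (fun w => expi (2 * pi * x w / N%:R)) ->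
  K (fun w => defect (M w) k (x w)).
Proof.
move=> Kc KD KM KMij Kx; apply: class_sum => // i.
have [qR qI] := @poly_class_comp_XaddC _ _ _ Kc KD KM N.+1 (fun w => char_poly (M w)) _
  (fun w => size_char_poly (M w)) (poly_class_char_poly Kc KD KM KMij) Kx i.
by apply: KD; under eq_fun do rewrite expr2; exact: KM.
Qed.

Lemma measurable_defect k x : measurable_fun setT (fun M => defect M k x).
Proof.
apply: (class_defect (M := id) (x := fun=> x)).
- by move=> a; exact: measurable_cst.
- by move=> f g; exact: measurable_funD.
- by move=> f g; exact: measurable_funM.
- move=> i j; apply/measurable_complexP.
  exact: (measurable_coordinate (i := (i, j)) (@matrix_measurableE R N)).
- by split; exact: measurable_cst.
Qed.

Lemma continuous_defect M k : continuous (defect M k).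
Proof.
apply: (class_defect (K := fun f : R -> R => continuous f) (M := fun=> M) (x := id)).
- by move=> a x; exact: cvg_cst.
- by move=> f g cf cg x; apply: cvgD; [exact: cf|exact: cg].
- by move=> f g cf cg x; apply: cvgM; [exact: cf|exact: cg].
- by move=> i j; split=> x; exact: cvg_cst.
have cl : continuous (fun x : R => 2 * pi * x / N%:R).
  by move=> x; apply: cvgMl; apply: cvgMr; exact: cvg_id.
split=> x /=; apply: (@continuous_comp _ _ _ _ _ x (cl x)).
  exact: continuous_cos.
exact: continuous_sin.
Qed.

Lemma measurable_angle_mult_hit k (a b : R) :
  measurable [set M | exists2 x, a < x < b & (k <= angle_mult M x)%N].
Proof.
have := measurable_zero_hitting (F := fun M => defect M k) (fun M => defect_ge0 M k)
  (measurable_defect k) (fun M => @continuous_defect M k) a b.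
congr measurable; apply/seteqP; split=> M [x xab /defect_eq0 cx]; exists x => //.
Qed.
End eigenvalue_multiplicities.

(** * Translation invariance of the eigenangles *)

Lemma mupZ (F : fieldType) (p : {poly F}) a x : a != 0 -> mup x (a *: p) = mup x p.
Proof.
move=> a0; have [->|p0] := eqVneq p 0; first by rewrite scaler0.
have ap0 : a *: p != 0 by rewrite scaler_eq0 negb_or a0.
have geqE k : (k <= mup x (a *: p))%N = (k <= mup x p)%N by rewrite !mup_geq// dvdpZr.
by apply/eqP; rewrite eqn_leq -geqE leqnn geqE leqnn.
Qed.

Lemma mup_comp_scaleX (F : fieldType) (p : {poly F}) a x : p != 0 -> a != 0 ->
  mup x (p \Po (a *: 'X)) = mup (a * x) p.
Proof.
move=> p0 a0.
(* Substituting a^-1 'X is inverse to substituting a 'X, so divisibility can be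
   transported in both directions. *)
have compK : (p \Po (a *: 'X)) \Po (a^-1 *: 'X) = p.
  by rewrite -comp_polyA comp_polyZ comp_polyX scalerA mulfV// scale1r comp_polyXr.
have q0 : p \Po (a *: 'X) != 0.
  by apply: contra_neq p0 => q0; rewrite -compK q0 comp_poly0.
have geqE k : (k <= mup x (p \Po (a *: 'X)))%N = (k <= mup (a * x) p)%N.
  rewrite !mup_geq//; apply/idP/idP.
    move=> /(dvdp_comp_poly (a^-1 *: 'X)); rewrite compK rmorphXn/=.
    rewrite comp_polyB comp_polyX comp_polyC.
    rewrite (_ : a^-1 *: 'X - x%:P = a^-1 *: ('X - (a * x)%:P)).
      by rewrite exprZn dvdpZl// expf_neq0// invr_eq0.
    by rewrite scalerBr -[_ *: (_)%:P]mul_polyC -polyCM mulKf.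
  move=> /(dvdp_comp_poly (a *: 'X)); rewrite rmorphXn/=.
  rewrite comp_polyB comp_polyX comp_polyC.
  rewrite (_ : a *: 'X - (a * x)%:P = a *: ('X - x%:P)).
    by rewrite exprZn dvdpZl// expf_neq0.
  by rewrite scalerBr -[_ *: (_)%:P]mul_polyC -polyCM.
by apply/eqP; rewrite eqn_leq -geqE leqnn geqE leqnn.
Qed.

Lemma char_poly_scale (F : fieldType) n (A : 'M[F]_n) a :
  char_poly (a *: A) \Po (a *: 'X) = a ^+ n *: char_poly A.
Proof.
rewrite /char_poly -det_map_mx.
rewrite (_ : map_mx _ _ = a%:P *: char_poly_mx A).
  by rewrite detZ -mul_polyC; congr (_ * _); rewrite rmorphXn.
apply/matrixP => i j; rewrite !mxE /= comp_polyB comp_polyC rmorphMn /= comp_polyX.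
by rewrite mulrBr -polyCM -mul_polyC mulrnAr.
Qed.

Lemma mup_char_poly_scale (F : fieldType) n (A : 'M[F]_n) a x : a != 0 ->
  mup (a * x) (char_poly (a *: A)) = mup x (char_poly A).
Proof.
move=> a0; rewrite -mup_comp_scaleX ?char_poly_scale ?mupZ ?expf_neq0//.
exact/monic_neq0/char_poly_monic.
Qed.

Section eigenangles.
Context (R : realType) (N : nat).
Hypothesis N_gt0 : (0 < N)%N.
Implicit Type M : 'M[R[i]]_N.

Lemma expi_neq0 (x : R) : expi x != 0.
Proof.
have := expiD x (- x); rewrite subrr => e; apply: contra_eq_neq e => ->.
by rewrite mul0r /expi cos0 sin0 oner_eq0.
Qed.

Lemma expi_eq1 (u : R) : expi (2 * pi * u) = 1 -> frac u = 0.
Proof.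
rewrite -expi_frac; have /andP[] := frac_itv u; move: (frac u) => v v0 v1 [cv _].
have pi0 := pi_gt0 R.
(* The cosine is injective on [0, pi] only; the angles beyond are reflected. *)
have [v2|v2] := leP v (1 / 2).
  have : 2 * pi * v = 0.
    by apply: cos_inj; rewrite ?in_itv/= ?cos0//; [nra|lra].
  by move=> /eqP; rewrite mulf_eq0 (gt_eqF (mulr_gt0 _ pi0))//= => /eqP.
have : 2 * pi - 2 * pi * v = 0.
  apply: cos_inj; rewrite ?in_itv/= ?cos0; [nra|lra|].
  have := @cosD2pi R (- (2 * pi * v)).
  by rewrite -[pi *+ 2]mulr_natl cosN cv addrC.
by move=> e; nra.
Qed.

(** There are finitely many eigenvalues, and an angle is determined by the
    eigenvalue together with the integer number of turns, which is bounded. *)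
Lemma finite_eigenangles M (a b : R) :
  finite_set [set x | a < x < b /\ angle_mult M x != 0%N].
Proof.
pose g (x : R) := (Num.floor (x / N%:R), expi (2 * pi * x / N%:R)).
have N0 : (0 : R) < N%:R by rewrite ltr0n.
have ginj : injective g.
  move=> x y [fxy cxy sxy].
  have exy : expi (2 * pi * x / N%:R) = expi (2 * pi * y / N%:R).
    by rewrite /expi cxy sxy.
  have : frac ((x - y) / N%:R) = 0.
    apply: expi_eq1; rewrite mulrA mulrBr mulrBl expiD exy -expiD subrr.
    by rewrite /expi cos0 sin0.
  move=> /eqP; rewrite subr_eq0 => /eqP xyz.
  have := frac_floorE (x / N%:R); have := frac_floorE (y / N%:R).
  have := frac_itv (x / N%:R); have := frac_itv (y / N%:R).
  rewrite -fxy => hy hx ey ex.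
  have dxy : (x - y) / N%:R = frac (x / N%:R) - frac (y / N%:R).
    by rewrite mulrBl {1}ex {1}ey opprD addrACA subrr addr0.
  have f0 : Num.floor ((x - y) / N%:R) = 0.
    have k1 : (Num.floor ((x - y) / N%:R) < 1)%R by rewrite -(ltr_int R); lra.
    have k2 : (-1 < Num.floor ((x - y) / N%:R))%R by rewrite -(ltr_int R); lra.
    by lia.
  move: xyz; rewrite f0 => /eqP; rewrite mulf_eq0 invr_eq0 (gt_eqF N0) orbF subr_eq0.
  by move=> /eqP.
have [rs rsE] := closed_field_poly_normal (char_poly M).
pose m1 := Num.floor (a / N%:R); pose m2 := Num.floor (b / N%:R).
pose B : set (int * R[i]) := [set k | m1 <= k <= m2] `*` [set` rs].
have fB : finite_set B.
  apply: finite_setX; last exact: finite_seq.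
  apply: (@sub_finite_set _ _ ((fun i : nat => m1 + i%:Z) @` `I_(`|m2 - m1|.+1)%N)).
    move=> k /= /andP[k1 k2]; exists `|k - m1|%N; last by lia.
    by rewrite /=; lia.
  exact/finite_image/finite_II.
apply: (sub_finite_set _ (finite_preimage (f := g) (B := B) _ fB)); last first.
  by move=> x y _ _; exact: ginj.
move=> x /= [/andP[ax xb] xM]; split => /=.
  by rewrite /m1 /m2 !le_floor// ler_pM2r ?invr_gt0// ltW.
have : root (char_poly M) (expi (2 * pi * x / N%:R)).
  by apply/negPn; apply: contra xM => /mupNroot; rewrite /angle_mult => ->.
rewrite rsE rootZ ?root_prod_XsubC//.
by rewrite (monicP (char_poly_monic M)) oner_eq0.
Qed.

Lemma tau_N_itv_lty M (a b : R) : (tau_N M `]a, b[%classic < +oo)%E.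
Proof.
rewrite tau_NE.
pose f x : \bar R := (angle_mult M x)%:R%:E.
have -> : \esum_(x in `]a, b[) f x =
    \esum_(x in [set x | a < x < b /\ angle_mult M x != 0%N]) f x.
  rewrite esum_mkcond [RHS]esum_mkcond; apply: eq_esum => x _.
  have [->|x0] := eqVneq (f x) 0%E; first by do 2 case: ifP.
  congr (if _ then _ else _); apply/idP/idP; rewrite !inE /= in_itv/=; last by case.
  by move=> xab; split => //; apply: contra_neq x0; rewrite /f => ->.
rewrite esum_fset; [|exact: finite_eigenangles|by move=> x _; rewrite lee_fin].
by rewrite fsbig_finite ?sumEFin ?ltry//; exact: finite_eigenangles.
Qed.

(** A random matrix with the given law has the form [perm_matrix s z] only almost
    surely, and the probability space need not be complete: measurability is
    needed on all matrices. *)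
Lemma measurable_tau_N : measurable_fun setT (@tau_N R N).
Proof.
apply: measurable_random_measure => [a b|]; last exact: tau_N_itv_lty.
under eq_fun do rewrite tau_NE.
apply: (measurable_esum_itv (c := @angle_mult R N)).
exact: measurable_angle_mult_hit.
Qed.

Lemma angle_mult_rotation (t : R) M (x : R) :
  angle_mult (expi (2 * pi * (t / N%:R)) *: M) (x + t) = angle_mult M x.
Proof.
rewrite /angle_mult.
have -> : 2 * pi * (x + t) / N%:R = 2 * pi * (t / N%:R) + 2 * pi * x / N%:R.
  by rewrite mulrDr mulrDl addrC mulrA.
by rewrite expiD mup_char_poly_scale ?expi_neq0.
Qed.

(** Multiplying the matrix by a point of the circle rotates its spectrum. *)
Lemma translate_tau_N (t : R) M :
  translate t (tau_N M) = tau_N (expi (2 * pi * (t / N%:R)) *: M) :> measures R.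
Proof.
apply: eq_measure; apply/funext => B; rewrite [LHS]tau_NE tau_NE.
rewrite [RHS](reindex_esum ((fun x => x + t) @^-1` B) _ (fun x => x + t)).
  by apply: eq_esum => x _; rewrite angle_mult_rotation.
split => //; first by move=> x y _ _; exact: addIr.
by move=> y By; exists (y - t); rewrite /= subrK.
Qed.

Lemma perm_matrix_scale (s : 'S_N) (z : 'I_N -> R[i]) c :
  perm_matrix s (fun j => c * z j) = c *: perm_matrix s z.
Proof. by apply/matrixP => j k; rewrite !mxE; case: ifP; rewrite ?mulr0. Qed.

Lemma tau_N_translation_invariant (theta : R) d (Omega : measurableType d)
    (P : probability Omega R) (M : {RV P >-> 'M[R[i]]_N}) :
  follows_ewens_matrix_law theta (@uniform_circle R) M ->
  translation_invariant_law P (fun w => tau_N (M w)).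
Proof.
case=> dd [OO] [P'] [s] [z] [_ zU indep lawM] t A mA.
have mtau : measurable (@tau_N R N @^-1` A).
  by rewrite -[_ @^-1` _]setTI; exact: measurable_tau_N.
have mttau : measurable ((fun L : 'M[R[i]]_N => translate t (tau_N L) : measures R) @^-1` A).
  rewrite -[_ @^-1` _]setTI.
  exact: (measurableT_comp (measurable_translate t) measurable_tau_N).
rewrite [RHS](lawM _ mtau) [LHS](lawM _ mttau) /pushforward.
rewrite -[RHS](perm_matrix_rotation_law zU indep (t / N%:R) mtau).
congr (P' _); apply/funext => w /=.
by rewrite translate_tau_N perm_matrix_scale.
Qed.

End eigenangles.

(** * The theorem *)

Theorem proposition5p1 (R : realType) (theta : R) (theta_gt0 : 0 < theta) :
  (forall (N : nat) (d : measure_display) (Omega : measurableType d)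
     (P : probability Omega R) (M : {RV P >-> 'M[R[i]]_N}),
     (0 < N)%N ->
     follows_ewens_matrix_law theta (@uniform_circle R) M ->
     translation_invariant_law P (fun w => tau_N (M w)))
  /\
  (forall (d : measure_display) (Omega : measurableType d)
     (P : probability Omega R) (x chi : {RV P >-> rseq R}),
     is_poisson_dirichlet theta x ->
     iid chi (@uniform01 R) ->
     independent x chi ->
     translation_invariant_law P (fun w => tau_infty (x w) (chi w))).
Proof.
split=> [N d Omega P M N_gt0 lawM|d Omega P x chi xPD chiU x_chi].
  exact: tau_N_translation_invariant lawM.
exact: tau_infty_translation_invariant xPD chiU x_chi.
Qed.
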